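(* Let $a$ and $q$ be independent indeterminates and let $(r,c,n) \in \mathbb{Z}_{\ge 0}^{3}$. Then, in $\mathbb{C}(a,q)$, $$\sum_{\pi \in \mathcal{P}(r,c,n)} q^{|\pi|} a^{\mathsf{tr}(\pi)} \omega_{n}(\pi;a;q) = \prod_{i=0}^{r-1} \prod_{j=0}^{c-1} \prod_{k=0}^{n-1} \frac{1-aq^{i+j+k+2}}{1-aq^{i+j+k+1}},$$ where $$\omega_{n}(\pi;a;q) = \prod_{k=1}^{\pi_{1,1}} \frac{(q^{n-k+1};q)_{\mathsf{D}(\lambda_k(\pi))}}{(aq^{n-k+1};q)_{\mathsf{D}(\lambda_k(\pi))}}$$ and $\pi_{1,1}$ denotes the $(1,1)$-part of the plane partition $\pi$.
   Context: A plane partition is an array $\pi=(\pi_{i,j})_{i,j\ge 1}$ of nonnegative integers with finite sum such that $\pi_{i,j}\ge \max\{\pi_{i+1,j},\pi_{i,j+1}\}$ for all $i,j \ge 1$. Its norm is $|\pi|=\sum_{i,j\ge 1}\pi_{i,j}$ and its trace is $\mathsf{tr}(\pi)=\sum_{i\ge1}\pi_{i,i}$. $\mathcal{P}(r,c,n)$ is the set of plane partitions with at most $r$ rows, at most $c$ columns and parts at most $n$, i.e. $\pi_{i,j}=0$ whenever $i>r$ or $j>c$, and $\pi_{1,1}\le n$. For $k\ge 1$, $\lambda_k(\pi)$ is the (integer) partition whose $i$-th part is the number of parts in the $i$-th row of $\pi$ that are at least $k$, i.e. $\#\{j\ge1 : \pi_{i,j}\ge k\}$. For a partition $\lambda$,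 $\mathsf{D}(\lambda)$ is the size of the Durfee square of $\lambda$, i.e. the number of boxes on the main diagonal of its Young diagram, $\mathsf{D}(\lambda)=\#\{i\ge 1:\lambda_i\ge i\}$. For $m \ge 0$, $(x;q)_m=\prod_{l=0}^{m-1}(1-xq^l)$, with $(x;q)_0=1$. Empty products equal $1$. *)

(* Defs.v *)
From HB Require Import structures.
From mathcomp Require Import all_boot all_order all_algebra.
From mathcomp Require Import finmap.
From mathcomp Require Import boolp classical_sets functions cardinality fsbigop reals.
From mathcomp Require Import complex.
From mathcomp Require Import mpoly.

Set Implicit Arguments.
Unset Strict Implicit.
Unset Printing Implicit Defensive.

Import GRing.Theory.

Local Open Scope classical_set_scope.
Local Open Scope ring_scope.

(* Rows and columns are numbered from 0: [p i j] is the entry in row i+1 and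
   column j+1.  For nonnegative integer entries, "finite sum" is the same as
   finitely many nonzero entries. *)
Definition plane_partition (p : nat -> nat -> nat) : Prop :=
  finite_set [set ij : nat * nat | p ij.1 ij.2 <> 0%N] /\
  (forall i j, (maxn (p i.+1 j) (p i j.+1) <= p i j)%N).

Definition boxed_plane_partitions (r c n : nat) : set (nat -> nat -> nat) :=
  [set p | [/\ plane_partition p,
               forall i j, (r <= i)%N || (c <= j)%N -> p i j = 0%N &
               (p 0%N 0%N <= n)%N]].

(* The finitely supported sums below range over all of nat * nat and nat; they
   are the true sums as soon as [p] is a plane partition. *)
Definition pp_norm (p : nat -> nat -> nat) : nat :=
  \big[addn/0%N]_(ij \in [set: nat * nat]) p ij.1 ij.2.

Definition pp_trace (p : nat -> nat -> nat) : nat :=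
  \big[addn/0%N]_(i \in [set: nat]) p i i.

(* [fset_set A] is the empty set when [A] is infinite; for k >= 1 and [p] a
   plane partition the sets counted in the next two definitions are finite. *)
Definition pp_lambda (k : nat) (p : nat -> nat -> nat) : nat -> nat :=
  fun i => #|` fset_set [set j : nat | (k <= p i j)%N]|.

(* With parts numbered from 0, lambda_i >= i becomes i < lam i. *)
Definition durfee (lam : nat -> nat) : nat :=
  #|` fset_set [set i : nat | (i < lam i)%N]|.

Definition qpoch (F : fieldType) (x q : F) (m : nat) : F :=
  \prod_(0 <= l < m) (1 - x * q ^+ l).

(* Only used when p 0 0 <= n, so that the subtraction n - k is not truncated. *)
Definition omega (F : fieldType) (n : nat) (p : nat -> nat -> nat) (a q : F) : F :=
  \prod_(1 <= k < (p 0%N 0%N).+1)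
    (qpoch (q ^+ (n - k + 1)) q (durfee (pp_lambda k p)) /
     qpoch (a * q ^+ (n - k + 1)) q (durfee (pp_lambda k p))).

(* C(a, q), with C = R[i] for R the real numbers: the fraction field of the
   polynomial ring over C in two variables, a being the variable of index 0
   and q the variable of index 1. *)
Definition ratfun2 (R : realType) : fieldType :=
  {fraction {mpoly R[i][2]}}.

Definition indet (R : realType) (v : 'I_2) : ratfun2 R :=
  tofrac ('X_v : {mpoly R[i][2]}).

Definition indet_a (R : realType) : ratfun2 R := indet R ord0.
Definition indet_q (R : realType) : ratfun2 R := indet R ord_max.

Lemma finite_boxed_plane_partitions (r c n : nat) :
  finite_set (boxed_plane_partitions r c n).
Proof.
pose f (g : {ffun 'I_r * 'I_c -> 'I_n.+1}) : nat -> nat -> nat := fun i j =>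
  match insub i, insub j with
  | Some i', Some j' => nat_of_ord (g (i', j'))
  | _, _ => 0%N
  end.
apply: (@sub_finite_set _ _ (f @` setT)); last first.
  by apply: finite_image; exact: finite_finset.
move=> p [[_ mono] supp le_n] /=.
have le0 i j : (p i j <= n)%N.
  have H0 m : (p m 0%N <= n)%N.
    elim: m => // m IH; apply: leq_trans IH.
    by have := mono m 0%N; rewrite geq_max => /andP[].
  elim: j => // j IH; apply: leq_trans IH.
  by have := mono i j; rewrite geq_max => /andP[].
exists [ffun ij : 'I_r * 'I_c => inord (p ij.1 ij.2)] => //.
apply/funext => i; apply/funext => j; rewrite /f.
case: insubP => [i' _ <-|]; last by rewrite -leqNgt => h; rewrite supp ?h.
case: insubP => [j' _ <-|]; last by rewrite -leqNgt => h; rewrite supp ?h ?orbT.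
by rewrite ffunE /= inordK // ltnS.
Qed.

(* Main.v *)
Require Import Defs.
From mathcomp Require Import all_boot all_order all_algebra ring zify.
From mathcomp Require Import finmap boolp classical_sets functions cardinality.
From mathcomp Require Import fsbigop reals complex mpoly.

(** The weight [omega n p a q] depends only on the main diagonal k of p: since
    the Durfee number of lambda_m(p) counts the diagonal parts >= m, it is a
    product over the boxes of the diagram of k, and
      a^tr(p) omega(p) = prod_i row_weight a i k_i =: W_a(k),
    rows being counted from 0.
    Cut p along its diagonals.  Consecutive diagonals interlace (m -< k means
    k_0 >= m_0 >= k_1 >= m_1 >= ...), so if B_c(k) = [branch q c k] is the
    generating function of the chains k >- m^1 >- ... >- m^c = 0 by
    |m^1| + ... + |m^c|, the left-hand side is
      Z(r, c; a) = sum_k B_r(k) q^|k| W_a(k) B_c(k)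
    ([boxed_sum_plane_partitions]).

    Everything then rests on a local move ([sum_interlace_toggle]) which
    replaces a partition k interlacing from above two given partitions l, m by a
    partition p interlacing them from below:
      sum_{k >- l, m} q^|k| W_a(k)
        = (1 - a q^(n+1)) / (1 - a q) W_{aq}(l) W_{aq}(m)
            sum_{p -< l, m} q^|p| / W_{aq^2}(p).
    It holds row by row.  Given l and m, the part k_{i+1} and the part p_i range
    over the same interval [max(l_{i+1}, m_{i+1}), min(l_i, m_i)], and k_0 over
    [max(l_0, m_0), n].  If S is a function and w = S(x) - S(x+1),
    v = 1/S(x+1) - 1/S(x), then both sum_{x=u}^{t-1} w = S(u) - S(t) and
    S(u) S(t) sum_{x=u}^{t-1} v are the same number; the weights above are
    of this form up to constant factors that match, S(x) being proportional to
    row i + 1 of W_{aq} at x and also to row i of W_{aq} at x - 1.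

    Expanding B_c(k) = sum_{m -< k} q^|m| B_{c-1}(m), applying the move and
    using induction on c for the inner sum over m (at a q instead of a) turns
    the move into the eigenfunction identity [sum_interlace_branch],
      sum_{k >- l} q^|k| W_a(k) B_c(k)
        = prod_{j<c} (1 - a q^(j+n+1)) / (1 - a q^(j+1)) W_{aq}(l) B_c(l).
    Expanding B_r(k) in Z and applying this identity removes one row:
      Z(r, c; a) = prod_{j<c} (1 - a q^(j+n+1)) / (1 - a q^(j+1)) Z(r-1, c; a q),
    and the product formula follows by induction on r, because the product over
    the third index on the right-hand side telescopes. *)

Set Implicit Arguments.
Unset Strict Implicit.
Unset Printing Implicit Defensive.

Import GRing.Theory.

Local Open Scope classical_set_scope.
Local Open Scope ring_scope.

(** * Weights of a single row *)

Section RowWeights.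
Variables (F : fieldType) (q : F) (n : nat).

(** What makes all denominators below invertible; it passes from a to a q
    ([generic_mulq]), which is how a changes along the induction. *)
Definition generic (a : F) : Prop :=
  [/\ a != 0, q != 0, forall k, 1 - a * q ^+ k.+1 != 0
    & forall k, 1 - q ^+ k.+1 != 0].

Lemma generic_mulq a : generic a -> generic (a * q).
Proof.
move=> [a0 q0 ha hq]; split=> // [|k]; first by rewrite mulf_neq0.
by rewrite -mulrA -exprS.
Qed.

(** The factors of a^tr(p) omega(p) coming from a part m in row i (from 0) of the
    main diagonal; box k of the row has content k - i. *)
Definition row_weight (a : F) (i m : nat) : F :=
  \prod_(0 <= k < m)
     (a * (1 - q ^+ (n + i - k)) / (1 - a * q ^+ (n + i - k))).

Lemma row_weight0 a i : row_weight a i 0 = 1.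
Proof. by rewrite /row_weight big_geq. Qed.

Lemma row_weightS a i m : row_weight a i m.+1 =
  row_weight a i m * (a * (1 - q ^+ (n + i - m)) / (1 - a * q ^+ (n + i - m))).
Proof. by rewrite /row_weight big_nat_recr. Qed.

(** Shifting row and column together keeps the content, so the rows i + 1 and i
    differ by the factor of the first box only. *)
Lemma row_weightSS a i m : row_weight a i.+1 m.+1 =
  a * (1 - q ^+ (n + i).+1) / (1 - a * q ^+ (n + i).+1) * row_weight a i m.
Proof.
rewrite /row_weight big_nat_recl // subn0 addnS; congr (_ * _).
Qed.

Lemma row_weight_neq0 a i m :
  generic a -> (m <= n)%N -> row_weight a i m != 0.
Proof.
move=> [a0 q0 ha hq]; elim: m => [|m IH] hm; first by rewrite row_weight0 oner_neq0.
rewrite row_weightS mulf_neq0 ?IH ?(ltnW hm) //.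
have -> : (n + i - m = (n + i - m).-1.+1)%N by lia.
by rewrite !mulf_neq0 ?invr_eq0.
Qed.

(** The bound n on the parts is thus built into the weight of the first row: it
    makes the sum over the largest part telescope without a boundary term. *)
Lemma row_weight_overflow a : row_weight a 0 n.+1 = 0.
Proof. by rewrite row_weightS addn0 subnn expr0 subrr mulr0 mul0r mulr0. Qed.

(** The denominators for a and a q are the same up to a shift of the content, so
    the quotient of the two weights telescopes. *)
Lemma row_weight_mulq a i m : generic a -> (m <= n)%N ->
  q ^+ m * row_weight a i m * (1 - a * q * q ^+ (n + i - m)) =
  (1 - a * q ^+ (n + i).+1) * row_weight (a * q) i m.
Proof.
move=> [a0 q0 ha hq]; elim: m => [|m IH] hm.
  by rewrite !row_weight0 subn0 exprS; ring.
move/(_ (ltnW hm)): IH => IH.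
rewrite !row_weightS.
have e : (n + i - m = (n + i - m.+1).+1)%N by lia.
have h1 := ha (n + i - m.+1)%N; have h2 := ha (n + i - m.+1).+1.
move: IH; rewrite {}e; set x := (n + i - m.+1)%N in h1 h2 *.
rewrite !exprS in h1 h2 *; set w := row_weight a i m; set w' := row_weight _ i m.
move=> IH.
have h3 : 1 - a * q * (q * q ^+ x) != 0 by rewrite -(mulrA a).
rewrite [RHS]mulrA -IH; field; rewrite ?h1 ?h3 //.
Qed.

(** The form w = S(x) - S(x+1) of the weights summed in the local move. *)
Lemma row_weight_telescope a i m : generic a -> (m <= n)%N ->
  (1 - a * q) * (q ^+ m * row_weight a i m) =
  (1 - a * q ^+ (n + i).+1) *
    (row_weight (a * q) i m - row_weight (a * q) i m.+1).
Proof.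
move=> ga hm; have := row_weight_mulq i ga hm.
rewrite row_weightS; case: ga => a0 q0 ha hq.
have h := ha (n + i - m)%N.
set x := (n + i - m)%N in h *; rewrite exprS mulrA in h.
set w := row_weight a i m; set w' := row_weight _ i m => e.
apply: (mulIf h); rewrite -[LHS]mulrA e; field; exact: h.
Qed.

(** The form v = 1/S(x+1) - 1/S(x) of the weights on the other side, up to a
    constant, where S(m) is row i + 1 of the weight for a q: by [row_weightSS],
    S(m+1) is a multiple of row i at m. *)
Lemma row_weight_inv_telescope a i m : generic a -> (m <= n)%N ->
  (1 - a * q) * (q ^+ m / row_weight (a * q * q) i m) =
  (1 - a * q ^+ (n + i).+2) / row_weight (a * q) i m
  - a * q * (1 - q ^+ (n + i).+1) / row_weight (a * q) i.+1 m.
Proof.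
move=> ga hm; have gq := generic_mulq ga; have gqq := generic_mulq gq.
have n0 := row_weight_neq0 i gq hm; have n1 := row_weight_neq0 i.+1 gq hm.
have n2 := row_weight_neq0 i gqq hm.
have e1 := row_weight_mulq i gq hm.
have e2 := row_weightSS (a * q) i m.
rewrite row_weightS addnS subSn ?(leq_trans hm) ?leq_addr // in e2.
case: ga => a0 q0 ha hq.
have h1 := ha (n + i)%N.+1; have h2 := ha (n + i - m)%N.+1.
have h3 := hq (n + i - m)%N.
have h4 := hq (n + i)%N.
move: n0 n1 n2 e1 e2.
set w0 := row_weight (a * q) i m; set w1 := row_weight _ i.+1 m.
set w2 := row_weight _ i m => n0 n1 n2.
set x := (n + i - m)%N in h2 h3 *; set y := (n + i)%N in h1 h4 *.
rewrite !exprS in h1 h2 h3 h4 *.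
have h2' : 1 - a * q * q * q ^+ x != 0 by rewrite -!mulrA.
have h1' : 1 - a * q * (q * q ^+ y) != 0 by rewrite -!mulrA.
have h2'' : 1 - a * q * (q * q ^+ x) != 0 by rewrite -!mulrA.
move=> e1 e2.
have f2 : w2 = q ^+ m * w0 * (1 - a * q * q * q ^+ x) / (1 - a * q * (q * q ^+ y)).
  by rewrite e1 mulrAC mulfV ?mul1r.
have f1 : w1 = w0 * (1 - q * q ^+ y) / (1 - a * q * (q * q ^+ y)) *
    ((1 - a * q * (q * q ^+ x)) / (1 - q * q ^+ x)).
  apply: (@mulIf _ (a * q * (1 - q * q ^+ x) / (1 - a * q * (q * q ^+ x)))).
    by rewrite !mulf_neq0 ?invr_eq0.
  rewrite e2; field; by rewrite h1' h2'' h3.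
have qm : q ^+ m != 0 by rewrite expf_neq0.
have -> : a * (q * (q * q ^+ y)) = a * q * (q * q ^+ y) by rewrite -!mulrA.
have q2 : q * q ^+ x - 1 != 0 by rewrite -opprB oppr_eq0.
rewrite f1 f2; field.
by rewrite ?n0 ?qm ?h1' ?h2' ?h2'' ?h3 ?h4.
Qed.

End RowWeights.

Section Intervals.
Variables (F : fieldType) (q : F) (n : nat).

Lemma sum_ord_interval (f : nat -> F) lo hi : (lo <= hi)%N -> (hi <= n)%N ->
  \sum_(m < n.+1 | (lo <= m <= hi)%N) f m = \sum_(lo <= m < hi.+1) f m.
Proof.
move=> lh hn; rewrite (big_nat_widen _ _ n.+1) // big_geq_mkord.
by apply: eq_bigl => m; rewrite /= ltnS andbC.
Qed.

Lemma sum_first_row a lo : generic q a -> (lo <= n)%N ->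
  \sum_(m < n.+1 | (lo <= m <= n)%N) q ^+ m * row_weight q n a 0 m =
  (1 - a * q ^+ n.+1) / (1 - a * q) * row_weight q n (a * q) 0 lo.
Proof.
move=> ga lon; have h : 1 - a * q != 0 by case: ga => _ _ /(_ 0%N); rewrite expr1.
rewrite (sum_ord_interval (fun m => q ^+ m * row_weight q n a 0 m)) //.
apply: (mulfI h); rewrite mulr_sumr.
rewrite (eq_big_nat _ _ (F2 := fun m => - ((1 - a * q ^+ n.+1) * row_weight q n (a * q) 0 m.+1) -
   - ((1 - a * q ^+ n.+1) * row_weight q n (a * q) 0 m))); last first.
  move=> m /andP[_ hm]; rewrite row_weight_telescope // addn0; ring.
rewrite telescope_sumr ?(leq_trans lon) // row_weight_overflow; field; exact: h.
Qed.

(** The sums telescope to S(lo) - S(hi+1) and U(hi+1) - U(lo), where U is a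
    constant multiple of 1/S and S(hi+1) is a multiple of row i at hi. *)
Lemma sum_next_row a i lo hi : generic q a -> (hi <= n)%N ->
  \sum_(m < n.+1 | (lo <= m <= hi)%N) q ^+ m * row_weight q n a i.+1 m =
  row_weight q n (a * q) i.+1 lo * row_weight q n (a * q) i hi *
  \sum_(m < n.+1 | (lo <= m <= hi)%N) q ^+ m / row_weight q n (a * q * q) i m.
Proof.
move=> ga hin; have [lohi|hilo] := leqP lo hi; last first.
  by rewrite !big1 ?mulr0 // => m /andP[h1 h2]; have := leq_trans h1 h2; rewrite leqNgt hilo.
have gq := generic_mulq ga.
have lon := leq_trans lohi hin.
have h : 1 - a * q != 0 by case: ga => _ _ /(_ 0%N); rewrite expr1.
have h1 : 1 - a * q * q ^+ (n + i).+1 != 0 by case: gq.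
rewrite (sum_ord_interval (fun m => q ^+ m * row_weight q n a i.+1 m)) //.
rewrite (sum_ord_interval (fun m => q ^+ m / row_weight q n (a * q * q) i m)) //.
apply: (mulfI h); rewrite mulrCA mulr_sumr [X in _ = _ * X]mulr_sumr.
pose S m := (1 - a * q ^+ (n + i).+2) * row_weight q n (a * q) i.+1 m.
pose U m := a * q * (1 - q ^+ (n + i).+1) / row_weight q n (a * q) i.+1 m.
have SS m : S m.+1 = a * q * (1 - q ^+ (n + i).+1) * row_weight q n (a * q) i m.
  rewrite /S row_weightSS (exprS _ (n + i).+1) (mulrA a).
  by field; exact: h1.
have US m : (m <= n)%N -> U m.+1 = (1 - a * q ^+ (n + i).+2) / row_weight q n (a * q) i m.
  move=> mn; rewrite /U row_weightSS (exprS _ (n + i).+1) (mulrA a).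
  have h2 := row_weight_neq0 i gq mn.
  case: gq => [aq0 q0 _ /(_ (n + i)%N) h3].
  have q1 : q ^+ (n + i).+1 - 1 != 0 by rewrite -opprB oppr_eq0.
  case: ga => a0 _ _ _.
  by field; rewrite ?h1 ?h2 ?h3 ?q1 ?q0 ?a0.
rewrite (eq_big_nat _ _ (F2 := fun m => (- S m.+1) - (- S m))); last first.
  move=> m /andP[_ hm]; rewrite row_weight_telescope ?(leq_trans _ hin) // addnS /S; ring.
rewrite telescope_sumr; last by rewrite (leq_trans lohi).
rewrite (eq_big_nat _ _ (F1 := fun m => (1 - a * q) * (q ^+ m / row_weight q n (a * q * q) i m))
   (F2 := fun m => U m.+1 - U m)); last first.
  by move=> m /andP[_ hm]; rewrite row_weight_inv_telescope ?US // ?(leq_trans _ hin).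
rewrite telescope_sumr; last by rewrite (leq_trans lohi).
rewrite SS US // /S /U.
have n0 := row_weight_neq0 i gq hin; have n1 := row_weight_neq0 i.+1 gq lon.
by field; rewrite n0 n1.
Qed.

End Intervals.

(** * Partitions and interlacing *)

Section Partitions.
Variables (N n : nat).
Implicit Types l k m p : {ffun 'I_N -> 'I_n.+1}.

(** Parts are extended by 0 beyond the N rows. *)
Definition part l (i : nat) : nat := if insub i is Some j then l j else 0%N.

Lemma part_ord l (i : 'I_N) : part l i = l i.
Proof. by rewrite /part valK. Qed.

Lemma part_ge l i : (N <= i)%N -> part l i = 0%N.
Proof. by move=> h; rewrite /part insubF // ltnNge h. Qed.

Lemma part_le l i : (part l i <= n)%N.
Proof. by rewrite /part; case: insub => // j; rewrite -ltnS. Qed.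

Lemma part_inj l m : part l =1 part m -> l = m.
Proof. by move=> h; apply/ffunP => i; apply/val_inj; rewrite /= -!part_ord h. Qed.

(** Interlacing makes l itself weakly decreasing, which is why the sums over
    [{ffun 'I_N -> 'I_n.+1}] below do not have to ask that l be a partition. *)
Definition interlace m l := [forall i : 'I_N, (part l i.+1 <= m i <= l i)%N].

Definition psize l := (\sum_i (l i : nat))%N.

Definition part0 : {ffun 'I_N -> 'I_n.+1} := [ffun=> ord0].

Lemma part_part0 i : part part0 i = 0%N.
Proof. by rewrite /part; case: insub => // j; rewrite ffunE. Qed.

Lemma interlaceP m l :
  reflect (forall i, (part l i.+1 <= part m i <= part l i)%N) (interlace m l).
Proof.
apply: (iffP forallP) => h i; last by rewrite -!part_ord.
have [iN|Ni] := ltnP i N; first by have := h (Ordinal iN); rewrite -!part_ord.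
by rewrite !part_ge // (leq_trans Ni).
Qed.

Lemma psize_part l : psize l = (\sum_(0 <= i < N) part l i)%N.
Proof. by rewrite big_mkord; apply: eq_bigr => i _; rewrite part_ord. Qed.

End Partitions.

(** * The local move *)

Section Toggle.
Variables (F : fieldType) (q : F) (n : nat).

Definition weight N (a : F) (l : {ffun 'I_N -> 'I_n.+1}) : F :=
  \prod_(i < N) row_weight q n a i (l i).

(** For given l and m the parts of k, and those of p, range independently over
    intervals, and part i + 1 of k over the same interval as part i of p.  Part 0
    of k gives the prefactor.  The last part of p is 0 by the hypothesis on l and
    m, so that no part of p is left without a partner. *)
Lemma sum_interlace_toggle N a (l m : {ffun 'I_N.+1 -> 'I_n.+1}) : generic q a ->
  minn (part l N) (part m N) = 0%N ->
  \sum_(k | interlace l k && interlace m k) q ^+ psize k * weight a k =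
  (1 - a * q ^+ n.+1) / (1 - a * q) * weight (a * q) l * weight (a * q) m *
  \sum_(p | interlace p l && interlace p m) q ^+ psize p / weight (a * q * q) p.
Proof.
move=> ga lm0.
pose lo i := maxn (part l i) (part m i); pose hi i := minn (part l i) (part m i).
have hin i : (hi i <= n)%N by rewrite geq_min part_le.
have lon i : (lo i <= n)%N by rewrite geq_max !part_le.
transitivity (\prod_(i < N.+1) \sum_(x < n.+1 |
    (lo i <= x <= (if (i : nat) is j.+1 then hi j else n))%N) q ^+ x * row_weight q n a i x).
  rewrite bigA_distr_big_dep; apply: eq_big => [k|k _].
    apply/andP/familyP => [[/interlaceP h1 /interlaceP h2] i|h].
      rewrite unfold_in -part_ord; case: i => [[|i] hi'] /=.
        by rewrite geq_max; have /andP[_ ->] := h1 0%N; have /andP[_ ->] := h2 0%N; rewrite part_le.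
      by rewrite geq_max leq_min; have /andP[_ ->] := h1 i.+1; have /andP[_ ->] := h2 i.+1;
         have /andP[-> _] := h1 i; have /andP[-> _] := h2 i.
    have hk i : (lo i <= part k i)%N && (part k i.+1 <= hi i)%N.
      have [iN|Ni] := ltnP i N.+1; last first.
        by rewrite /lo !(part_ge _ Ni) maxnn part_ge // (leq_trans Ni).
      have := h (Ordinal iN); rewrite unfold_in -part_ord /= => /andP[-> _] /=.
      have [iN1|Ni1] := ltnP i.+1 N.+1; last by rewrite part_ge.
      by have := h (Ordinal iN1); rewrite unfold_in -part_ord /= => /andP[].
    by split; apply/interlaceP => i; have /andP[] := hk i;
      rewrite /lo /hi geq_max leq_min => /andP[h1 h2] /andP[h3 h4];
      apply/andP.
  rewrite /psize /weight expr_sum -big_split /=; by [].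
have -> : \sum_(p | interlace p l && interlace p m) q ^+ psize p / weight (a * q * q) p
   = \prod_(i < N.+1) \sum_(x < n.+1 | (lo i.+1 <= x <= hi i)%N)
        q ^+ x / row_weight q n (a * q * q) i x.
  rewrite bigA_distr_big_dep; apply: eq_big => [p|p _].
    apply/andP/familyP => [[/interlaceP h1 /interlaceP h2] i|h].
      by rewrite unfold_in -part_ord geq_max leq_min;
         have /andP[-> ->] := h1 i; have /andP[-> ->] := h2 i.
    by split; apply/forallP => i; have := h i; rewrite unfold_in -!part_ord geq_max leq_min
       => /andP[/andP[h1 h2] /andP[h3 h4]]; apply/andP.
  by rewrite /psize /weight expr_sum -prodfV -big_split.
rewrite -(mulrA _ (weight _ l)).
have -> : weight (a * q) l * weight (a * q) m =
   \prod_(i < N.+1) row_weight q n (a * q) i (lo i) *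
   \prod_(i < N.+1) row_weight q n (a * q) i (hi i).
  rewrite /weight -!big_split; apply: eq_bigr => i _ /=; rewrite -!part_ord /lo /hi.
  by case: leqP => // _; rewrite mulrC.
set b := a * q * q.
rewrite big_ord_recl /= sum_first_row // -!mulrA; congr (_ * (_ * _)).
rewrite [X in _ = X * _]big_ord_recl [X in _ = _ * (X * _)]big_ord_recr.
rewrite [X in _ = _ * (_ * X)]big_ord_recr /=.
have hiN : hi N = 0%N by [].
rewrite hiN row_weight0 mulr1 -!mulrA; congr (_ * _).
have -> : \sum_(x < n.+1 | (lo N.+1 <= x <= 0)%N) q ^+ x / row_weight q n b N x = 1.
  rewrite /lo !part_ge // (big_pred1 ord0) ?row_weight0 ?expr0 ?divr1 // => x.
  by rewrite /= leqn0.
rewrite mulr1 -!big_split; apply: eq_bigr => i _ /=.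
by rewrite mulrA; exact: sum_next_row.
Qed.

End Toggle.

(** * Branching functions and the sum over the main diagonal *)

Section Branching.
Variables (F : fieldType) (q : F) (n : nat).

(** By the branching rule, this is the Schur function s_k(1, q, ..., q^(c-1)). *)
Fixpoint branch N (c : nat) (k : {ffun 'I_N -> 'I_n.+1}) : F :=
  if c is c'.+1 then \sum_(m | interlace m k) q ^+ psize m * branch c' m
  else (k == part0 N n)%:R.

(** A chain of c interlacings ending at 0 starts at a partition with at most c
    rows. *)
Lemma branch_eq0 N c i (k : {ffun 'I_N -> 'I_n.+1}) :
  (c <= i)%N -> part k i != 0%N -> branch c k = 0.
Proof.
elim: c i k => [|c IH] i k /=.
  by move=> _; case: (k =P _) => // ->; rewrite part_part0.
case: i => // i ci hk; apply: big1 => m /interlaceP /(_ i) /andP[h _].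
by rewrite (IH i) ?mulr0 //; move: hk; rewrite -!lt0n => /leq_trans; apply.
Qed.

Lemma weight_neq0 N a (k : {ffun 'I_N -> 'I_n.+1}) :
  generic q a -> weight q a k != 0.
Proof.
move=> ga; apply/prodf_neq0 => i _; apply: row_weight_neq0 => //.
by rewrite -ltnS.
Qed.

Lemma weight_part0 N a : weight q a (part0 N n) = 1.
Proof. by rewrite /weight big1 // => i _; rewrite ffunE row_weight0. Qed.

Lemma psize_part0 N : psize (part0 N n) = 0%N.
Proof. by rewrite /psize big1 // => i _; rewrite ffunE. Qed.

Lemma interlace_part0 N (l : {ffun 'I_N -> 'I_n.+1}) :
  interlace l (part0 N n) = (l == part0 N n).
Proof.
apply/interlaceP/eqP => [h|-> i]; last by rewrite !part_part0.
by apply: part_inj => i; have := h i; rewrite !part_part0 => /andP[_]; rewrite leqn0 => /eqP.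
Qed.

(** Induction on c: expand the branching function, apply the local move to the
    sum over k, and apply the induction hypothesis at a q to the sum over m.  The
    weight this produces for p cancels the denominator of the local move, and what
    remains is the expansion of the branching function of l. *)
Lemma sum_interlace_branch N c a (l : {ffun 'I_N.+1 -> 'I_n.+1}) :
  generic q a -> part l N = 0%N ->
  \sum_(k | interlace l k) q ^+ psize k * weight q a k * branch c k =
  \prod_(0 <= j < c) ((1 - a * q ^+ (j + n).+1) / (1 - a * q ^+ j.+1))
    * weight q (a * q) l * branch c l.
Proof.
elim: c a l => [|c IH] a l ga l0 /=.
  rewrite big_geq // mul1r.
  have [->|ln0] := eqVneq l (part0 _ _).
    rewrite weight_part0 mul1r (bigD1 (part0 _ _)) ?interlace_part0 //=.
    rewrite psize_part0 weight_part0 eqxx !mul1r big1 ?addr0 //.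
    by move=> k /andP[_ /negPf ->]; rewrite mulr0.
  rewrite mulr0 big1 // => k lk; case: eqP => [ek|]; last by rewrite mulr0.
  by move: lk ln0; rewrite ek interlace_part0 => ->.
have gq := generic_mulq ga; have gqq := generic_mulq gq.
pose K := (1 - a * q ^+ n.+1) / (1 - a * q).
pose K' := \prod_(0 <= j < c) ((1 - a * q * q ^+ (j + n).+1) / (1 - a * q * q ^+ j.+1)).
have -> : \prod_(0 <= j < c.+1) ((1 - a * q ^+ (j + n).+1) / (1 - a * q ^+ j.+1)) = K * K'.
  rewrite big_nat_recl // expr1; congr (_ * _); apply: eq_bigr => j _.
  by rewrite -!mulrA -!exprS.
transitivity (\sum_m q ^+ psize m * branch c m *
    \sum_(k | interlace l k && interlace m k) q ^+ psize k * weight q a k).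
  under eq_bigr do rewrite mulr_sumr.
  rewrite (exchange_big_dep xpredT) //=; apply: eq_bigr => m _.
  by rewrite mulr_sumr; apply: eq_bigr => k _; rewrite mulrC.
transitivity (\sum_m \sum_(p | interlace p l && interlace p m)
    K * weight q (a * q) l * (q ^+ psize p / weight q (a * q * q) p) *
    (q ^+ psize m * weight q (a * q) m * branch c m)).
  apply: eq_bigr => m _; rewrite sum_interlace_toggle ?l0 ?min0n // mulr_sumr mulr_sumr.
  by apply: eq_bigr => p _; rewrite -/K; ring.
rewrite (exchange_big_dep (fun p => interlace p l)) /=; last first.
  by move=> m p _ /andP[].
rewrite mulr_sumr; apply: eq_bigr => p pl.
have p0 : part p N = 0%N.
  by have /interlaceP/(_ N) := pl; rewrite l0 leqn0 => /andP[_ /eqP].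
have IHp := IH _ _ gq p0.
transitivity (K * weight q (a * q) l * (q ^+ psize p / weight q (a * q * q) p) *
   \sum_(m | interlace p m) q ^+ psize m * weight q (a * q) m * branch c m).
  by rewrite mulr_sumr pl.
rewrite IHp -/K'.
by field; apply: weight_neq0.
Qed.

Definition diagonal_sum N r c a : F :=
  \sum_(k : {ffun 'I_N -> 'I_n.+1})
     branch r k * (q ^+ psize k * weight q a k) * branch c k.

(** Induction on r: expanding the left branching function, the sum over k is the
    left-hand side of [sum_interlace_branch].  Its hypothesis on the last row of l
    holds because the left branching function of l vanishes otherwise. *)
Lemma diagonal_sum_prod N r c a : (r <= N)%N -> generic q a ->
  diagonal_sum N r c a = \prod_(0 <= i < r) \prod_(0 <= j < c)
     ((1 - a * q ^+ (i + j + n).+1) / (1 - a * q ^+ (i + j).+1)).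
Proof.
elim: r a => [|r IH] a rN ga.
  rewrite big_geq // /diagonal_sum (bigD1 (part0 _ _)) //= big1 => [|k /negPf ->].
    rewrite eqxx psize_part0 weight_part0 !mul1r addr0.
    elim: c => [|c IH] /=; first by rewrite eqxx.
    rewrite (big_pred1 (part0 _ _)) => [|m]; first by rewrite psize_part0 mul1r.
    by rewrite interlace_part0.
  by rewrite !mul0r.
case: N rN IH => // N rN IH.
have gq := generic_mulq ga.
rewrite big_nat_recl //.
transitivity (\sum_l q ^+ psize l * branch r l *
    \sum_(k : {ffun 'I_N.+1 -> 'I_n.+1} | interlace l k)
       q ^+ psize k * weight q a k * branch c k).
  rewrite /diagonal_sum /=.
  under eq_bigr do rewrite -mulrA mulr_suml.
  rewrite (exchange_big_dep xpredT) //=; apply: eq_bigr => m _.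
  by rewrite mulr_sumr; apply: eq_bigr => k _.
transitivity (\prod_(0 <= j < c) ((1 - a * q ^+ (j + n).+1) / (1 - a * q ^+ j.+1))
  * diagonal_sum N.+1 r c (a * q)).
  rewrite /diagonal_sum mulr_sumr; apply: eq_bigr => l _.
  have [l0|l1] := eqVneq (part l N) 0%N.
    by rewrite sum_interlace_branch //; ring.
  by rewrite (branch_eq0 (i := N)) // mulr0 !mul0r mulr0.
rewrite IH ?(ltnW rN) //; congr (_ * _).
apply: eq_bigr => i _; apply: eq_bigr => j _.
by rewrite -!mulrA -!exprS.
Qed.

End Branching.

(** * Branching functions as sums over chains *)

Section Chains.
Variables (N n : nat).
Notation prt := {ffun 'I_N -> 'I_n.+1}.

Definition chain (k : prt) (s : seq prt) : bool :=
  path (fun x y => interlace y x) k s && (last k s == part0 N n).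

Lemma branch_chain (F : fieldType) (q : F) c k : branch q c k =
  \sum_(s : c.-tuple prt | chain k s) q ^+ (\sum_(m <- s) psize m)%N.
Proof.
elim: c k => [|c IH] k /=.
  rewrite big_mkcond (big_pred1 [tuple]) => [|s]; last by apply/esym/eqP; exact: tuple0.
  by rewrite /chain /= big_nil; case: eqP.
rewrite (reindex (fun x : prt * c.-tuple prt => [tuple of x.1 :: x.2])) /=; last first.
  exists (fun s : c.+1.-tuple prt => (thead s, [tuple of behead s])) => [[m s] _|s _].
    by congr (_, _) => //; apply/val_inj.
  by rewrite [RHS]tuple_eta.
under eq_bigr do rewrite IH mulr_sumr.
rewrite pair_big_dep /=; apply: eq_big => [[m s]|[m s] _] /=.
  by rewrite /chain /= andbA.
by rewrite big_cons exprD.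
Qed.

(** Read beyond its end, a chain continues by empty partitions, so these
    inequalities hold for all d. *)
Lemma chain_nth k s : chain k s -> forall d i,
  [/\ (part (nth (part0 N n) (k :: s) d.+1) i <= part (nth (part0 N n) (k :: s) d) i)%N,
      (part (nth (part0 N n) (k :: s) d) i.+1 <= part (nth (part0 N n) (k :: s) d.+1) i)%N
    & (size s <= d)%N -> part (nth (part0 N n) (k :: s) d) i = 0%N].
Proof.
move=> /andP[/(pathP (part0 N n)) sk /eqP sl] d i.
have z e j : (size s <= e)%N -> part (nth (part0 N n) (k :: s) e) j = 0%N.
  rewrite leq_eqVlt => /predU1P[<-|h]; last by rewrite nth_default ?part_part0.
  by rewrite -[size s]/((size (k :: s)).-1) nth_last /= sl part_part0.
have [ds|sd] := ltnP d (size s).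
  by have /interlaceP/(_ i)/andP[h1 h2] := sk d ds; split => // /(leq_trans ds); rewrite ltnn.
by rewrite !z // ltnW.
Qed.

(** Half of an array, read by diagonals, is a chain: u d i is the i-th entry
    (from 0) of the diagonal at distance d from the main one. *)
Lemma chain_exists c (u : nat -> nat -> nat) k :
  (forall d i, (u d i <= n)%N) ->
  (forall d i, (N <= i)%N || (c <= d)%N -> u d i = 0%N) ->
  (forall d i, (u d i.+1 <= u d.+1 i <= u d i)%N) ->
  part k =1 u 0%N ->
  exists2 s : c.-tuple prt, chain k s
    & forall d i, part (nth (part0 N n) (k :: s) d) i = u d i.
Proof.
move=> un u0 um ku.
pose row d : prt := [ffun i : 'I_N => inord (u d i)].
have rowE d i : part (row d) i = u d i.
  rewrite /part; case: insubP => [j _ <-|]; first by rewrite ffunE inordK // ltnS.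
  by rewrite -leqNgt => h; rewrite u0 ?h.
have sE d i : part (nth (part0 N n) (k :: [tuple row (d : 'I_c).+1 | d < c]) d) i = u d i.
  case: d => [|d]; first by rewrite ku.
  have [dc|cd] := ltnP d c; last by rewrite nth_default ?size_tuple // part_part0 u0 // (leqW cd) orbT.
  have := tnth_mktuple (fun e : 'I_c => row e.+1) (Ordinal dc).
  by rewrite (tnth_nth (part0 N n)) /= => ->; rewrite rowE.
exists [tuple row (d : 'I_c).+1 | d < c] => //.
apply/andP; split.
  by apply/(pathP (part0 N n)) => d _; apply/interlaceP => i;
     rewrite -[nth _ (tval _) d]/(nth (part0 N n) (k :: [tuple row (d : 'I_c).+1 | d < c]) d.+1) !sE.
apply/eqP/part_inj => i; rewrite part_part0.
rewrite (last_nth (part0 N n)) size_tuple sE u0 // leqnn orbT //.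
Qed.

End Chains.

(** * Norm, trace and weight in terms of diagonals *)

Section Statistics.
Local Open Scope nat_scope.

Lemma card_fset_set_downset (A : set nat) b l :
  (forall i j, i <= j -> A j -> A i) -> ~ A b ->
  (l < #|` fset_set A|) = `[< A l >].
Proof.
move=> Adown Ab.
have exA : exists b, ~~ `[< A b >] by exists b; apply/asboolPn.
have -> : A = `I_(ex_minn exA).
  case: ex_minnP => d /asboolPn Ad dmin; apply/seteqP; split=> i /=.
    by move=> Ai; rewrite ltnNge; apply/negP => /Adown /(_ Ai).
  by move=> id; apply: contrapT => /asboolPn /dmin; rewrite leqNgt id.
rewrite (card_fset_set (card_eqxx _)).
by apply/idP/asboolP.
Qed.

Lemma sum_square_diagonal (u : nat -> nat -> nat) M :
  \sum_(0 <= i < M) \sum_(0 <= j < M) u i j =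
  \sum_(0 <= i < M) u i i + \sum_(0 <= i < M) \sum_(i.+1 <= j < M) u i j +
  \sum_(0 <= j < M) \sum_(j.+1 <= i < M) u i j.
Proof.
have -> : \sum_(0 <= j < M) \sum_(j.+1 <= i < M) u i j =
          \sum_(0 <= i < M) \sum_(0 <= j < i) u i j.
  under eq_bigr do rewrite (big_nat_widenl _ 0) //.
  rewrite (exchange_big_dep_nat xpredT) //=.
  apply: eq_big_nat => i iM; rewrite [RHS](big_nat_widen _ _ M) //.
  by case/andP: iM => _ /ltnW.
rewrite addnC -!big_split /=; apply: eq_big_nat => i /andP[_ iM].
by rewrite (big_cat_nat (leq0n i) (ltnW iM)) /= (big_ltn iM).
Qed.

Lemma sum_nat_trim (f : nat -> nat) m M : m <= M ->
  (forall i, m <= i -> f i = 0) -> \sum_(0 <= i < M) f i = \sum_(0 <= i < m) f i.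
Proof.
move=> mM f0; rewrite (big_cat_nat (leq0n m) mM) /= [X in _ + X]big_nat_cond.
by rewrite [X in _ + X]big1 ?addn0 // => i /andP[/andP[/f0]].
Qed.

(** Summing i over r values for every d overshoots the triangle j < M, but the
    entries added lie outside the support of u. *)
Lemma sum_superdiagonals (u : nat -> nat -> nat) r c M :
  (forall i j, i < j -> (r <= i) || (c <= j) -> u i j = 0) -> r <= M -> c <= M ->
  \sum_(0 <= i < M) \sum_(i.+1 <= j < M) u i j =
  \sum_(0 <= d < c) \sum_(0 <= i < r) u i (i + d.+1).
Proof.
move=> u0 rM cM; rewrite [RHS]exchange_big_nat (sum_nat_trim rM); last first.
  by move=> i ri; rewrite big_nat big1 // => j /andP[ij _]; rewrite u0 ?ri.
apply: eq_bigr => i _; rewrite -{1}[i.+1]add0n big_addn.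
have uz d : c - i.+1 <= d -> u i (d + i.+1) = 0.
  by rewrite leq_subLR addnC => h; rewrite u0 ?h ?orbT // leq_addl.
rewrite (sum_nat_trim (m := c - i.+1)) ?leq_sub2r //.
rewrite [RHS](sum_nat_trim (m := c - i.+1)) ?leq_subr //.
  by apply: eq_bigr => d _; rewrite -addSnnS addSn addnC addnS.
by move=> d h; rewrite -addSnnS addnC uz.
Qed.

Lemma decreasing_array_le (u : nat -> nat -> nat) i j i' j' :
  (forall i j, maxn (u i.+1 j) (u i j.+1) <= u i j) ->
  i' <= i -> j' <= j -> u i j <= u i' j'.
Proof.
move=> mono ii jj; apply: (@leq_trans (u i' j)).
  elim: i ii => [|i IH]; first by rewrite leqn0 => /eqP ->.
  rewrite leq_eqVlt => /predU1P[<- //|/IH]; apply: leq_trans.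
  by have := mono i j; rewrite geq_max => /andP[].
elim: j jj => [|j IH]; first by rewrite leqn0 => /eqP ->.
rewrite leq_eqVlt => /predU1P[<- //|/IH]; apply: leq_trans.
by have := mono i' j; rewrite geq_max => /andP[].
Qed.

Variables (r c n : nat) (p : nat -> nat -> nat).
Hypothesis pP : boxed_plane_partitions r c n p.

Lemma boxed_antitone i j i' j' : i' <= i -> j' <= j -> p i j <= p i' j'.
Proof. by case: pP => [[_ mono] _ _]; exact: decreasing_array_le. Qed.

Lemma boxed_bound i j : p i j <= n.
Proof. by apply: leq_trans (boxed_antitone (leq0n _) (leq0n _)) _; case: pP. Qed.

Lemma boxed_out i j : (r <= i) || (c <= j) -> p i j = 0.
Proof. by case: pP => _ h _; apply: h. Qed.

(** Rows decrease, so row l has more than l parts >= k exactly when its diagonal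
    part is >= k; the diagonal decreases too, so these l form an initial segment. *)
Lemma durfee_lambda k l : 0 < k -> (l < durfee (pp_lambda k p)) = (k <= p l l).
Proof.
move=> k0.
have lamE i : (i < pp_lambda k p i) = (k <= p i i).
  rewrite /pp_lambda (@card_fset_set_downset _ c) ?asboolb //=.
    by move=> j j' jj /leq_trans; apply; exact: boxed_antitone.
  by rewrite boxed_out ?leqnn ?orbT // leqNgt k0.
rewrite /durfee (@card_fset_set_downset _ r) /= ?lamE ?asboolb //.
  by move=> i j ij; rewrite !lamE => /leq_trans; apply; exact: boxed_antitone.
by rewrite boxed_out ?leqnn // leqNgt k0.
Qed.

Lemma pp_trace_boxed : pp_trace p = \sum_(0 <= i < r) p i i.
Proof.
rewrite /pp_trace big_mkord (fsbig_ord _ r (fun i => p i i)).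
apply/esym/fsbig_widen => // i [_ /= /negP]; rewrite -leqNgt => h.
by rewrite boxed_out ?h.
Qed.

Lemma pp_norm_square M : r <= M -> c <= M ->
  pp_norm p = \sum_(0 <= i < M) \sum_(0 <= j < M) p i j.
Proof.
move=> rM cM; rewrite /pp_norm -(fsbig_widen (`I_M `*` `I_M)) //; last first.
  move=> [i j] [_ /= ij]; apply: boxed_out; rewrite leqNgt [_ <= j]leqNgt -negb_and.
  by apply/negP => /andP[ir jc]; apply: ij; split=> /=; [exact: leq_trans rM|exact: leq_trans cM].
rewrite -(pair_fsbig _ p) //= big_mkord (fsbig_ord _ _ (fun i => \sum_(0 <= j < M) p i j)).
by apply: eq_fsbigr => i _; rewrite big_mkord (fsbig_ord _ _ (p i)).
Qed.


Lemma pp_norm_boxed : pp_norm p =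
  \sum_(0 <= i < r) p i i + \sum_(0 <= d < c) \sum_(0 <= i < r) p i (i + d.+1) +
  \sum_(0 <= d < r) \sum_(0 <= i < r) p (i + d.+1) i.
Proof.
have rM := leq_maxl r c; have cM := leq_maxr r c.
rewrite (pp_norm_square rM cM) sum_square_diagonal.
rewrite (sum_superdiagonals (fun i j _ => @boxed_out i j) rM cM).
rewrite (@sum_superdiagonals (fun j i => p i j) r r) //.
  by rewrite (sum_nat_trim rM) // => i ri; rewrite boxed_out ?ri.
by move=> j i ji /orP h; rewrite boxed_out //; case: h => [/leq_trans -> //|->//]; exact: ltnW.
Qed.

(** By [durfee_lambda] the index set of the double product defining omega is the
    diagram of the main diagonal; here it is read along rows instead of columns. *)
Lemma omega_boxed (F : fieldType) (a q : F) :
  (a ^+ pp_trace p * omega n p a q = \prod_(0 <= i < r) row_weight q n a i (p i i))%R.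
Proof.
pose f m i : F := ((1 - q ^+ (n + i - m)) / (1 - a * q ^+ (n + i - m)))%R.
have -> : (omega n p a q = \prod_(0 <= i < r) \prod_(0 <= m < p i i) f m i)%R.
  transitivity (\prod_(0 <= m < p 0 0) \prod_(0 <= i < r | (m < p i i)%N) f m i)%R.
    rewrite /omega big_add1 /=; apply: eq_big_nat => m /andP[_ mp].
    have mn : m < n := leq_trans mp (boxed_bound 0 0).
    have D_r : durfee (pp_lambda m.+1 p) <= r.
      by rewrite leqNgt durfee_lambda // boxed_out ?leqnn.
    under [RHS]eq_bigl do rewrite -durfee_lambda //.
    rewrite -[RHS](big_nat_widen 0 _ _ xpredT) // /qpoch -prodf_div.
    apply: eq_bigr => i _; rewrite /f -mulrA -!exprD.
    by have -> : n - m.+1 + 1 + i = n + i - m by lia.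
  rewrite (exchange_big_dep_nat xpredT) //=; apply: eq_bigr => i _.
  by rewrite [RHS](big_nat_widen _ _ (p 0 0)) //; exact: boxed_antitone.
rewrite pp_trace_boxed expr_sum -big_split; apply: eq_bigr => i _ /=.
have -> : (a ^+ p i i = \prod_(0 <= m < p i i) a)%R by rewrite prodr_const_nat subn0.
rewrite /row_weight -big_split.
by apply: eq_bigr => m _; rewrite /f /= mulrA.
Qed.

End Statistics.

(** * Plane partitions as pairs of chains *)

Section Gluing.
Local Open Scope nat_scope.
Variables (r c n : nat).
Notation prt := {ffun 'I_r -> 'I_n.+1}.
Notation triple := (prt * r.-tuple prt * c.-tuple prt)%type.

Definition diag_row (k : prt) (s : seq prt) (d i : nat) : nat :=
  part (nth (part0 r n) (k :: s) d) i.

(** The diagonals on and above the main one come from the second chain, those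
    below it from the first one. *)
Definition glue (x : triple) (i j : nat) : nat :=
  if i <= j then diag_row x.1.1 x.2 (j - i) i
  else diag_row x.1.1 x.1.2 (i - j) j.

Definition chains (x : triple) : bool := chain x.1.1 x.1.2 && chain x.1.1 x.2.

Lemma glue_upper x d i : glue x i (i + d) = diag_row x.1.1 x.2 d i.
Proof. by rewrite /glue leq_addr addKn. Qed.

Lemma glue_lower x d i : glue x (i + d) i = diag_row x.1.1 x.1.2 d i.
Proof.
case: d => [|d]; first by rewrite addn0 /glue leqnn subnn.
by rewrite /glue leqNgt addnS ltnS leq_addr /= -addnS addKn.
Qed.

(** The two interlacing inequalities between neighbouring diagonals are the row
    and column monotonicity.  The chains end at 0 after r and c steps, which
    kills the entries (r, 0) and (0, c), hence all entries in rows >= r and in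
    columns >= c. *)
Lemma glue_boxed x : chains x -> boxed_plane_partitions r c n (glue x).
Proof.
case/andP => /chain_nth ht /chain_nth hs.
have mono i j : maxn (glue x i.+1 j) (glue x i j.+1) <= glue x i j.
  rewrite geq_max; apply/andP; split; have [ij|ji] := leqP i j.
  - move: ij; rewrite leq_eqVlt => /predU1P[<-|ij].
      rewrite -[X in glue x i X]addn0 glue_upper -addn1 glue_lower.
      by have [] := ht 0 i.
    rewrite -(subnKC ij) glue_upper addSnnS glue_upper.
    by have [] := hs (j - i.+1) i.
  - by rewrite -(subnKC (ltnW ji)) -addnS !glue_lower; have [] := ht (i - j) j.
  - by rewrite -(subnKC ij) -addnS !glue_upper; have [] := hs (j - i) i.
  - rewrite -(subnKC ji) glue_lower addSnnS glue_lower.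
    by have [] := ht (i - j.+1) j.
have anti i j i' j' : i' <= i -> j' <= j -> glue x i j <= glue x i' j'.
  exact: decreasing_array_le.
have zero i j : (r <= i) || (c <= j) -> glue x i j = 0.
  move=> h; apply/eqP; rewrite -leqn0; case/orP: h => h.
    apply: leq_trans (anti _ _ _ _ h (leq0n j)) _; rewrite -[r]add0n glue_lower.
    by have [_ _ e] := ht r 0; rewrite /diag_row e ?size_tuple.
  apply: leq_trans (anti _ _ _ _ (leq0n i) h) _; rewrite -[c]add0n glue_upper.
  by have [_ _ e] := hs c 0; rewrite /diag_row e ?size_tuple.
split=> //; last by rewrite -{2}[0]addn0 glue_upper part_le.
split=> //; apply: (@sub_finite_set _ _ (`I_r `*` `I_c)).
  by move=> [i j] /= h; split => /=; rewrite ltnNge; apply/negP => h'; apply: h;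
     rewrite zero // h' ?orbT.
exact: finite_setX.
Qed.

Lemma diag_row_inj m k (s t : m.-tuple prt) :
  diag_row k s =2 diag_row k t -> s = t.
Proof.
move=> e; apply/val_inj/(@eq_from_nth _ (part0 r n)); first by rewrite !size_tuple.
by move=> d _; apply: part_inj => i; exact: (e d.+1 i).
Qed.

Lemma glue_bij : set_bij [set` chains] (boxed_plane_partitions r c n) glue.
Proof.
split.
- by move=> x; exact: glue_boxed.
- move=> [[k t] s] [[k' t'] s'] _ _ e.
  have eu d i : diag_row k s d i = diag_row k' s' d i.
    by have := glue_upper (k, t, s) d i; rewrite e glue_upper.
  have el d i : diag_row k t d i = diag_row k' t' d i.
    by have := glue_lower (k, t, s) d i; rewrite e glue_lower.
  have ek : k = k' by apply: part_inj => i; exact: (eu 0 i).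
  rewrite {}ek in eu el *.
  by rewrite (diag_row_inj eu) (diag_row_inj el).
- move=> p pP /=.
  pose k : prt := [ffun i : 'I_r => inord (p i i)].
  have kE i : part k i = p i i.
    rewrite /part; case: insubP => [j _ <-|].
      by rewrite ffunE inordK // ltnS (boxed_bound pP).
    by rewrite -leqNgt => h; rewrite (boxed_out pP) ?h.
  have anti := boxed_antitone pP; have out := boxed_out pP.
  have [||||s ks sE] := @chain_exists r n c (fun d i => p i (i + d)) k.
  + by move=> d i; exact: (boxed_bound pP).
  + move=> d i /orP[h|h]; apply: out; first by rewrite h.
    by rewrite (leq_trans h) ?leq_addl ?orbT.
  + by move=> d i; rewrite -addSnnS !anti // leq_addr.
  + by move=> i; rewrite addn0.
  have [||||t kt tE] := @chain_exists r n r (fun d i => p (i + d) i) k.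
  + by move=> d i; exact: (boxed_bound pP).
  + move=> d i /orP[h|h]; apply: out; first by rewrite (leq_trans h) ?leq_addr.
    by rewrite (leq_trans h) ?leq_addl.
  + by move=> d i; rewrite -addSnnS !anti // leq_addr.
  + by move=> i; rewrite addn0.
  exists (k, t, s); first by apply/andP.
  apply/funext => i; apply/funext => j; case: (leqP i j) => h.
    by rewrite -(subnKC h) glue_upper /diag_row sE.
  by rewrite -(subnKC (ltnW h)) glue_lower /diag_row tE.
Qed.

Lemma glue_norm x : chains x ->
  pp_norm (glue x) = psize x.1.1 + \sum_(m <- x.2) psize m + \sum_(m <- x.1.2) psize m.
Proof.
move=> cx; rewrite (pp_norm_boxed (glue_boxed cx)) psize_part.
have sumE m (s : m.-tuple prt) k :
    \sum_(y <- s) psize y = \sum_(0 <= d < m) \sum_(0 <= i < r) diag_row k s d.+1 i.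
  rewrite (big_nth (part0 r n)) size_tuple.
  by apply: eq_bigr => d _; rewrite psize_part.
rewrite (sumE _ _ x.1.1) [X in _ = _ + X](sumE _ _ x.1.1).
congr (_ + _ + _).
- by apply: eq_bigr => i _; rewrite -[X in glue x i X]addn0 glue_upper.
- by apply: eq_bigr => d _; apply: eq_bigr => i _; rewrite glue_upper.
- by apply: eq_bigr => d _; apply: eq_bigr => i _; rewrite glue_lower.
Qed.

End Gluing.

(** * The box formula *)

(** Cutting a plane partition along its diagonals, with partitions of r rows on
    all of them. *)
Lemma boxed_sum_plane_partitions (F : fieldType) (a q : F) r c n :
  \sum_(p \in boxed_plane_partitions r c n)
     q ^+ pp_norm p * a ^+ pp_trace p * omega n p a q = diagonal_sum q n r r c a.
Proof.
rewrite (reindex_fsbig (@glue r c n) [set` @chains r c n]); last exact: glue_bij.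
rewrite -(@bigfs _ _ _ _ (index_enum _) (@chains r c n)) ?index_enum_uniq //; last first.
  by move=> x _; rewrite mem_index_enum.
transitivity (\sum_k \sum_(t : r.-tuple {ffun 'I_r -> 'I_n.+1} | chain k t)
    \sum_(s : c.-tuple {ffun 'I_r -> 'I_n.+1} | chain k s)
    q ^+ (\sum_(m <- t) psize m)%N * (q ^+ psize k * weight q a k) *
    q ^+ (\sum_(m <- s) psize m)%N).
  rewrite pair_big_dep /= pair_big_dep /=; apply: eq_bigr => x cx.
  rewrite glue_norm // -mulrA (omega_boxed (glue_boxed cx)) !exprD.
  have -> : \prod_(0 <= i < r) row_weight q n a i (glue x i i) = weight q a x.1.1.
    rewrite /weight big_mkord; apply: eq_bigr => i _.
    by rewrite -[X in glue x i X]addn0 glue_upper /diag_row /= part_ord.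
  ring.
rewrite /diagonal_sum; apply: eq_bigr => k _.
rewrite !branch_chain -mulrA !mulr_suml; apply: eq_bigr => t _.
by rewrite !mulr_sumr; apply: eq_bigr => s _; rewrite !mulrA.
Qed.

(** A polynomial with a nonzero value is nonzero: evaluate at (1, 1) or (0, 0). *)
Lemma generic_indet (R : realType) : generic (indet_q R) (indet_a R).
Proof.
have ev (f : {mpoly R[i][2]}) v : f.@[v] != 0 -> tofrac f != 0.
  by rewrite tofrac_eq0; apply: contraNneq => ->; rewrite meval0.
split.
- by apply: (ev _ (fun=> 1)); rewrite mevalXU oner_neq0.
- by apply: (ev _ (fun=> 1)); rewrite mevalXU oner_neq0.
- move=> k; rewrite /indet_a /indet_q /indet -!(tofracXn, tofracM, tofrac1, tofracB).
  by apply: (ev _ (fun=> 0)); rewrite mevalB mevalM meval1 mevalXU mul0r subr0 oner_neq0.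
- move=> k; rewrite /indet_q /indet -!(tofracXn, tofracM, tofrac1, tofracB).
  apply: (ev _ (fun=> 0)); rewrite mevalB meval1 rmorphXn /= mevalXU expr0n subr0 oner_neq0 //.
Qed.

Theorem theorem9 (R : realType) (r c n : nat) :
  let a : ratfun2 R := indet_a R in
  let q : ratfun2 R := indet_q R in
  \sum_(p \in boxed_plane_partitions r c n)
     q ^+ pp_norm p * a ^+ pp_trace p * omega n p a q =
  \prod_(0 <= i < r) \prod_(0 <= j < c) \prod_(0 <= k < n)
     ((1 - a * q ^+ (i + j + k + 2)) / (1 - a * q ^+ (i + j + k + 1))).
Proof.
move=> a q; have gaq : generic q a := generic_indet R.
have [_ _ ga _] := gaq.
rewrite boxed_sum_plane_partitions diagonal_sum_prod //.
apply: eq_bigr => i _; apply: eq_bigr => j _.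
pose f k := 1 - a * q ^+ (i + j + k).+1.
have f0 k : f k != 0 by exact: ga.
transitivity (f n / f 0%N); first by rewrite /f addn0.
have [->|n0] := posnP n; first by rewrite big_geq // divff.
rewrite -telescope_prodf //.
by apply: eq_bigr => k _; rewrite /f addn2 addn1 addnS.
Qed.
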